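(* Let $T$ be a tree on $n\geq 6$ vertices such that $p(T)=q(T)$ and $T$ contains no pendant path $P_3$. Then $$m_{L(T)}(1)\leq \frac{n-6}{4},$$ and equality holds if and only if $T$ is isomorphic to the following tree $T_k$ for some integer $k\geq 0$ (so $n=4k+6$): take vertices $c_0,c_1,\dots,c_k$; attach one pendant vertex to each $c_i$; for each $0\le i\le k-1$ join $c_i$ and $c_{i+1}$ by a path $c_i a_i b_i c_{i+1}$ with two new internal vertices $a_i,b_i$ of degree $2$; finally attach to $c_0$ a pendant path $c_0 x_1 x_2$ and to $c_k$ a pendant path $c_k y_1 y_2$ (new vertices $x_1,x_2,y_1,y_2$, with $x_2,y_2$ pendant). (For $k=0$, $T_0$ is the tree on $6$ vertices consisting of a vertex $c_0$ with one pendant neighbor and two pendant paths of length $2$.)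
   Context: All graphs are finite, simple and undirected. $L(G)=D(G)-A(G)$ is the Laplacian matrix, and $m_{L(G)}(1)$ is the multiplicity of $1$ as an eigenvalue of $L(G)$. A pendant vertex has degree $1$; a quasi-pendant vertex is adjacent to a pendant vertex; $p(G)$, $q(G)$ are the numbers of pendant and quasi-pendant vertices. A pendant path $P_k$ of $G$ means that $G$ is obtained from a graph $G_1$ and a path $P_k$ by joining one end vertex of $P_k$ to a vertex of $G_1$ by an edge. *)

(* Defs.v *)
From HB Require Import structures.
From mathcomp Require Export all_boot all_order all_algebra.
Set Implicit Arguments.
Unset Strict Implicit.
Unset Printing Implicit Defensive.
Import Order.TTheory GRing.Theory Num.Theory.

Definition simple_graph (T : finType) (e : rel T) : Prop :=
  symmetric e /\ irreflexive e.

Definition graph_iso (T1 T2 : finType) (e1 : rel T1) (e2 : rel T2) : Prop :=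
  exists f : T1 -> T2, bijective f /\ forall x y, e1 x y = e2 (f x) (f y).

(* [ucycle] also accepts one vertex with a loop and the two ends of an edge;
   genuine cycles have at least three vertices. *)
Definition acyclic (T : finType) (e : rel T) : Prop :=
  forall c : seq T, 2 < size c -> ~ ucycle e c.

Definition is_tree (T : finType) (e : rel T) : Prop :=
  [/\ simple_graph e, 0 < #|T|, forall x y, connect e x y & acyclic e].

Definition degree (T : finType) (e : rel T) (x : T) : nat := #|[set y | e x y]|.

Definition pendant (T : finType) (e : rel T) (x : T) : bool := degree e x == 1.

Definition quasi_pendant (T : finType) (e : rel T) (x : T) : bool :=
  [exists y, pendant e y && e x y].

Definition num_pendant (T : finType) (e : rel T) : nat :=
  #|[set x | pendant e x]|.

Definition num_quasi_pendant (T : finType) (e : rel T) : nat :=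
  #|[set x | quasi_pendant e x]|.

(* The disjoint union of (T1, e1) and the path 0 - 1 - ... - k-1, with the end
   vertex 0 of the path joined to u. *)
Definition attach_path (T1 : finType) (e1 : rel T1) (u : T1) (k : nat) :
    rel (T1 + 'I_k)%type :=
  fun v w => match v, w with
  | inl x, inl y => e1 x y
  | inl x, inr i | inr i, inl x => (x == u) && (i == 0 :> nat)
  | inr i, inr j => (j == i.+1 :> nat) || (i == j.+1 :> nat)
  end.

Definition has_pendant_path (k : nat) (T : finType) (e : rel T) : Prop :=
  exists (T1 : finType) (e1 : rel T1) (u : T1),
    simple_graph e1 /\ graph_iso e (attach_path e1 u (k := k)).

Section Laplacian.
Local Open Scope ring_scope.
Variable R : comNzRingType.

(* Rows and columns are indexed by the canonical enumeration of the vertices. *)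
Definition degree_mx (T : finType) (e : rel T) : 'M[R]_#|T| :=
  diag_mx (\row_i (degree e (enum_val i))%:R).

Definition adjacency_mx (T : finType) (e : rel T) : 'M[R]_#|T| :=
  \matrix_(i, j) (e (enum_val i) (enum_val j))%:R.

Definition laplacian (T : finType) (e : rel T) : 'M[R]_#|T| :=
  degree_mx e - adjacency_mx e.

End Laplacian.

Definition eigen_mult (F : fieldType) (n : nat) (A : 'M[F]_n) (a : F) : nat :=
  mup a (char_poly A).

(* [TD i] is the pendant vertex attached to [TC i]. *)
Inductive Tk_vertex (k : nat) : Type :=
  | TC of 'I_k.+1 | TD of 'I_k.+1
  | TA of 'I_k | TB of 'I_k
  | TX1 | TX2 | TY1 | TY2.
Arguments TX1 {k}.
Arguments TX2 {k}.
Arguments TY1 {k}.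
Arguments TY2 {k}.

Section TkFinite.
Variable k : nat.

Definition Tk_code (v : Tk_vertex k) :
    ('I_k.+1 + 'I_k.+1 + ('I_k + 'I_k) + 'I_4)%type :=
  match v with
  | TC i => inl (inl (inl i)) | TD i => inl (inl (inr i))
  | TA i => inl (inr (inl i)) | TB i => inl (inr (inr i))
  | TX1 => inr (inord 0) | TX2 => inr (inord 1)
  | TY1 => inr (inord 2) | TY2 => inr (inord 3)
  end.

Definition Tk_decode (c : 'I_k.+1 + 'I_k.+1 + ('I_k + 'I_k) + 'I_4) :
    Tk_vertex k :=
  match c with
  | inl (inl (inl i)) => TC i | inl (inl (inr i)) => TD i
  | inl (inr (inl i)) => TA i | inl (inr (inr i)) => TB i
  | inr j => nth TX1 [:: TX1; TX2; TY1; TY2] j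
  end.

Lemma Tk_codeK : cancel Tk_code Tk_decode.
Proof. by case=> //=; rewrite inordK. Qed.

HB.instance Definition _ := Equality.copy (Tk_vertex k) (can_type Tk_codeK).
HB.instance Definition _ := Choice.copy (Tk_vertex k) (can_type Tk_codeK).
HB.instance Definition _ := Countable.copy (Tk_vertex k) (can_type Tk_codeK).
HB.instance Definition _ := Finite.copy (Tk_vertex k) (can_type Tk_codeK).

Lemma Tk_decodeK : cancel Tk_decode Tk_code.
Proof.
case=> [[[i|i]|[i|i]]|] // [[|[|[|[|j]]]] lt_j] //=;
  by congr inr; apply: val_inj; rewrite /= inordK.
Qed.

Lemma card_Tk : #|{: Tk_vertex k}| = 4 * k + 6.
Proof.
have bij : bijective Tk_code.
  by exists Tk_decode; [exact: Tk_codeK | exact: Tk_decodeK].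
rewrite (bij_eq_card bij) !card_sum !card_ord !addSn !addnS addn0.
by rewrite !mulSn mul0n !addnA !addn0.
Qed.

End TkFinite.

(* Each edge of T_k, in one direction. *)
Definition Tk_arc (k : nat) (v w : Tk_vertex k) : bool :=
  match v, w with
  | TC i, TD j => i == j
  | TC i, TA j => i == j :> nat
  | TA i, TB j => i == j
  | TB i, TC j => j == i.+1 :> nat
  | TC i, TX1 => i == ord0
  | TX1, TX2 => true
  | TC i, TY1 => i == ord_max
  | TY1, TY2 => true
  | _, _ => false
  end.

Definition Tk (k : nat) : rel (Tk_vertex k) :=
  fun v w => Tk_arc v w || Tk_arc w v.

(* Main.v *)
Require Import Defs.
From mathcomp Require Import all_boot all_order all_algebra.
From mathcomp Require Import zify ring.
Set Implicit Arguments.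
Unset Strict Implicit.
Unset Printing Implicit Defensive.
Import Order.TTheory GRing.Theory Num.Theory.

(** The Laplacian is symmetric, so the multiplicity [m] of [1] is the dimension
   of its eigenspace. An eigenfunction vanishes on the [q] quasi-pendant
   vertices, and its values on the pendant vertices are determined by the
   others; so it is given by its values on the inner vertices, those neither
   pendant nor quasi-pendant. As [p = q], there are [h = n - 2 q] of them.

   Root the tree at a quasi-pendant vertex of degree two. Let [b] be the number
   of inner vertices without inner children, the inner leaves, and [a] that of
   anchors: the quasi-pendant vertices with a quasi-pendant parent, and the inner
   vertices of degree at least three with a quasi-pendant child.
   - The equations propagate zeros upwards from the inner leaves, so [m <= b];
     the inner vertices of one depth parity also determine an eigenfunction, so
     [2 m <= h].
   - Counting the quasi-pendant vertices by their parents, [b + a < q].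
   - Without pendant [P_3], there is an anchor below every inner vertex; this
     gives [a >= 2] unless [h = 1], in which case [m = 0].
   Hence [4 m <= 2 b + h <= n - 2 - 2 a <= n - 6].

   In the equality case [m = b] and [h = 2 b]. The first equality lets one
   interpolate arbitrary values on the inner leaves, which forces the inner
   vertices to form disjoint pairs of adjacent vertices of degree two. Then
   there are exactly two anchors, both quasi-pendant, and all vertices that are
   not pendant lie on one path from the root. *)

(** * Multiplicities of eigenvalues *)

Section MatrixMultiplicity.
Local Open Scope ring_scope.

Lemma char_poly_similar (F : fieldType) m n (P : 'M[F]_(m, n)) A B :
    row_free P -> row_full P -> P *m A = B *m P ->
  char_poly A = char_poly B.
Proof.
move=> freeP fullP; have eq_mn : m = n by rewrite -(eqP freeP) (eqP fullP).
move: P A B freeP {fullP}; rewrite eq_mn => P A B.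
rewrite row_free_unit unitmxE unitfE => detP_neq0 PA.
set PX := map_mx (@polyC F) P.
have PXA : PX *m char_poly_mx A = char_poly_mx B *m PX.
  rewrite /char_poly_mx mulmxBr mulmxBl -!map_mxM PA.
  by rewrite mul_mx_scalar mul_scalar_mx.
have detPX_neq0 : \det PX != 0 by rewrite det_map_mx polyC_eq0.
by apply: (mulfI detPX_neq0); rewrite -det_mulmx PXA det_mulmx mulrC.
Qed.

Lemma char_poly_diag_block (R : comNzRingType) m n (A : 'M[R]_m) (B : 'M[R]_n) :
  char_poly (block_mx A 0 0 B) = char_poly A * char_poly B.
Proof.
rewrite /char_poly /char_poly_mx map_block_mx !map_mx0 -[_%:M]/(_%:M).
by rewrite scalar_mx_block opp_block_mx add_block_mx !oppr0 !addr0 det_lblock.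
Qed.

Lemma char_poly_scalar (R : comNzRingType) n (a : R) :
  char_poly (a%:M : 'M_n) = ('X - a%:P) ^+ n.
Proof.
rewrite char_poly_trig ?scalar_mx_is_trig //.
by under eq_bigr do rewrite mxE eqxx; rewrite prodr_const card_ord.
Qed.

(* The hypothesis makes the space the direct sum of the eigenspace and of the
   image of [A - a%:M], on which [a] is not an eigenvalue. *)
Lemma eigen_mult_semisimple (F : fieldType) n (A : 'M[F]_n) (a : F) :
    (eigenspace A a :&: (A - a%:M) = 0)%MS ->
  eigen_mult A a = \rank (eigenspace A a).
Proof.
set E := eigenspace A a; set N := A - a%:M => EN0.
pose V := row_base N; pose D := conjmx V A.
have stableV : stablemx V A.
  rewrite stablemx_row_base; apply/submxP; exists A.
  by rewrite /N mulmxBl mulmxBr scalar_mxC.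
have VA : V *m A = D *m V by rewrite mulmxKpV.
have freeV : row_free V := row_base_free N.
have EA : row_base E *m A = a%:M *m row_base E.
  by rewrite mul_scalar_mx; apply/eigenspaceP; rewrite eq_row_base.
have rankEN : (\rank E + \rank N = n)%N.
  by rewrite mxrank_ker subnK ?rank_leq_row.
have rankEV : \rank (col_mx (row_base E) V) = n.
  rewrite -addsmxE (adds_eqmx (eq_row_base E) (eq_row_base N)).
  by rewrite mxrank_disjoint_sum.
rewrite /eigen_mult (char_poly_similar (P := col_mx (row_base E) V)
  (B := block_mx a%:M 0 0 D)); last first.
- by rewrite mul_col_mx mul_block_col EA VA !mul0mx addr0 add0r.
- by rewrite /row_full rankEV.
- by rewrite /row_free rankEV rankEN.
rewrite char_poly_diag_block char_poly_scalar mupMl ?mup_XsubCX ?eqxx //.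
rewrite -eigenvalue_root_char; apply/negPn/eqP.
have := submx_refl (eigenspace D a); rewrite sub_eigenspace_conjmx // => DE.
apply/eqP; rewrite -(mulmx_free_eq0 _ freeV) -submx0 -EN0 sub_capmx DE.
by rewrite (submx_trans (submxMl _ _)) ?eq_row_base.
Qed.

Lemma mulmx_tr_eq0 (R : realDomainType) n (v : 'rV[R]_n) :
  v *m v^T = 0 -> v = 0.
Proof.
move=> /matrixP /(_ 0 0); rewrite !mxE => sum0.
apply/rowP => i; rewrite mxE; apply/eqP; rewrite -sqrf_eq0 expr2.
have /psumr_eq0P : forall j, true -> 0 <= v 0 j * v^T j 0.
  by move=> j _; rewrite mxE -expr2 sqr_ge0.
by move=> /(_ sum0 i isT); rewrite mxE => ->.
Qed.

Lemma eigen_mult_symmetric (F : realFieldType) n (A : 'M[F]_n) (a : F) :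
  A^T = A -> eigen_mult A a = \rank (eigenspace A a).
Proof.
move=> symA; apply: eigen_mult_semisimple.
apply/eqP; rewrite -submx0; apply/rV_subP => w; rewrite sub_capmx submx0.
case/andP=> /sub_kermxP wN0 /submxP [v def_w]; apply/eqP/mulmx_tr_eq0.
rewrite {1}def_w -mulmxA -[X in v *m (X *m _)]trmxK -trmx_mul.
by rewrite linearB /= symA tr_scalar_mx wN0 trmx0 mulmx0.
Qed.

Lemma rank_colsub (F : fieldType) m n k (K : 'M[F]_(m, n)) (g : 'I_k -> 'I_n) :
    (forall v : 'rV_n, (v <= K)%MS -> colsub g v = 0 -> v = 0) ->
  \rank (colsub g K) = \rank K.
Proof.
move=> g_inj; have colsubE p (M : 'M_(p, n)) : colsub g M = M *m colsub g 1%:M.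
  by rewrite mulmx_colsub mulmx1.
rewrite colsubE -[RHS](mxrank_mul_ker K (colsub g 1%:M)).
suff ->: (K :&: kermx (colsub g 1%:M))%MS = 0 by rewrite mxrank0 addn0.
apply/eqP; rewrite -submx0; apply/rV_subP => v; rewrite sub_capmx submx0.
by case/andP=> vK /sub_kermxP; rewrite -colsubE => /(g_inj v vK) ->.
Qed.

End MatrixMultiplicity.

Section Eigenfunctions.
Local Open Scope ring_scope.
Variables (R : comNzRingType) (T : finType) (e : rel T).
Implicit Types (a : R) (f : T -> R).

Definition lap_eigenfun a f : Prop :=
  forall x, \sum_(y | e x y) (f x - f y) = a * f x.

Lemma sum_nbr_const x (c : R) : \sum_(y | e x y) c = (degree e x)%:R * c.
Proof.
rewrite sumr_const mulr_natl; congr (_ *+ _).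
by apply: eq_card => y; rewrite !inE.
Qed.

Lemma lap_eigenfunE a f :
  lap_eigenfun a f <->
    forall x, \sum_(y | e x y) f y = ((degree e x)%:R - a) * f x.
Proof.
split=> eig x; have := eig x; rewrite ?sumrB sum_nbr_const mulrBl.
  by move=> <-; rewrite opprB addrC subrK.
by move=> ->; rewrite opprB addrC subrK.
Qed.

Lemma lap_eigenfun_nbr a f x y : lap_eigenfun a f -> e x y ->
    (forall z, e x z -> z != y -> f z = 0) ->
  f y = ((degree e x)%:R - a) * f x.
Proof.
move=> /lap_eigenfunE eig xy f0; rewrite -eig (bigD1 y) //=.
by rewrite big1 ?addr0 // => z /andP []; apply: f0.
Qed.

Definition forcing_set a (Z : {set T}) : Prop :=
  forall f, lap_eigenfun a f -> {in Z, forall z, f z = 0} -> forall x, f x = 0.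

Definition fun_of_row (v : 'rV[R]_#|T|) : T -> R := fun x => v 0 (enum_rank x).

Hypothesis sym_e : symmetric e.

Lemma laplacian_sym : (laplacian R e)^T = laplacian R e.
Proof.
by apply/matrixP => i j; rewrite !mxE sym_e eq_sym; case: eqP => [->|].
Qed.

Lemma row_mul_laplacian (v : 'rV_#|T|) x :
  fun_of_row (v *m laplacian R e) x =
    \sum_(y | e x y) (fun_of_row v x - fun_of_row v y).
Proof.
rewrite sumrB sum_nbr_const mulrC /fun_of_row mulmxBr mul_mx_diag !mxE.
rewrite enum_rankK; congr (_ - _); rewrite [RHS]big_mkcond.
rewrite (reindex_onto enum_rank enum_val) /=.
  apply: eq_big => [y|y _]; first by rewrite enum_rankK eqxx.
  by rewrite !mxE !enum_rankK sym_e; case: ifP; rewrite ?mulr1 ?mulr0.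
by move=> i _; apply: enum_valK.
Qed.

End Eigenfunctions.

Section EigenMultiplicity.
Local Open Scope ring_scope.
Variables (F : realFieldType) (T : finType) (e : rel T).
Hypothesis sym_e : symmetric e.
Implicit Types (a : F) (x y z : T).

Lemma row_eigenspaceP a (v : 'rV_#|T|) :
  (v <= eigenspace (laplacian F e) a)%MS <-> lap_eigenfun e a (fun_of_row v).
Proof.
split=> [/eigenspaceP vL x|eig].
  by rewrite -row_mul_laplacian // vL /fun_of_row mxE.
apply/eigenspaceP/rowP => i; rewrite -(enum_valK i).
by rewrite -[LHS]/(fun_of_row _ _) row_mul_laplacian // eig mxE.
Qed.

Lemma eigen_mult_laplacian a :
  eigen_mult (laplacian F e) a = \rank (eigenspace (laplacian F e) a).
Proof. exact/eigen_mult_symmetric/laplacian_sym. Qed.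

Lemma eigen_mult_ge_family a k (phi : 'I_k -> T -> F) (x : 'I_k -> T) :
    (forall i, lap_eigenfun e a (phi i)) ->
    (forall i j, phi i (x j) = (i == j)%:R) ->
  (k <= eigen_mult (laplacian F e) a)%N.
Proof.
move=> eig phi_x; rewrite eigen_mult_laplacian.
pose V : 'M[F]_(k, #|T|) := \matrix_(i, j) phi i (enum_val j).
have VE : (V <= eigenspace (laplacian F e) a)%MS.
  apply/row_subP => i; apply/row_eigenspaceP.
  have rowV y : fun_of_row (row i V) y = phi i y.
    by rewrite /fun_of_row !mxE enum_rankK.
  by move=> y; rewrite rowV -eig; apply: eq_bigr => z _; rewrite rowV.
apply: leq_trans (mxrankS VE).
have colsubV : colsub (enum_rank \o x) V = 1%:M.
  by apply/matrixP => i j; rewrite !mxE enum_rankK.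
rewrite -[k in (k <= _)%N](mxrank1 F) -colsubV -[V in colsub _ V]mulmx1.
by rewrite -mulmx_colsub mxrankM_maxl.
Qed.

Section ForcingSet.
Variables (a : F) (Z : {set T}).
Hypothesis forcingZ : forcing_set e a Z.

Let restrict_to_Z n (M : 'M[F]_(n, #|T|)) : 'M_(n, #|Z|) :=
  colsub (enum_rank \o enum_val) M.

Let rank_restricted_eigenspace :
  \rank (restrict_to_Z (eigenspace (laplacian F e) a)) =
    eigen_mult (laplacian F e) a.
Proof.
rewrite eigen_mult_laplacian; apply: rank_colsub => v /row_eigenspaceP eig vZ0.
apply/rowP => i; rewrite mxE -(enum_valK i); apply: (forcingZ eig) => z Zz.
have /rowP /(_ (enum_rank_in Zz z)) := vZ0.
by rewrite !mxE /= enum_rankK_in.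
Qed.

Lemma eigen_mult_le_forcing : (eigen_mult (laplacian F e) a <= #|Z|)%N.
Proof. by rewrite -rank_restricted_eigenspace rank_leq_col. Qed.

Lemma forcing_interpolation z :
    eigen_mult (laplacian F e) a = #|Z| -> z \in Z ->
  exists f : T -> F, [/\ lap_eigenfun e a f, f z = 1 &
    {in Z, forall y, y != z -> f y = 0}].
Proof.
move=> multZ Zz; set E := eigenspace (laplacian F e) a.
have /row_fullP [D DE] : row_full (restrict_to_Z E).
  by rewrite /row_full rank_restricted_eigenspace multZ.
pose v := row (enum_rank_in Zz z) D *m E.
have vE y (Zy : y \in Z) : fun_of_row v y = (z == y)%:R.
  have -> : fun_of_row v y = restrict_to_Z v 0 (enum_rank_in Zz y).
    by rewrite [RHS]mxE /= enum_rankK_in.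
  rewrite /restrict_to_Z -mulmx_colsub -/(restrict_to_Z E) -row_mul DE !mxE.
  by rewrite -(inj_eq enum_val_inj) !enum_rankK_in.
exists (fun_of_row v); split; first exact/row_eigenspaceP/submxMl.
  by rewrite vE ?eqxx.
by move=> y Zy ne_yz; rewrite vE // eq_sym (negPf ne_yz).
Qed.

End ForcingSet.

End EigenMultiplicity.

(** * Graphs *)

Section Degree.
Variables (T : finType) (e : rel T).
Implicit Types (x y z : T) (s : seq T).

Lemma degree_gt0P x : reflect (exists y, e x y) (0 < degree e x).
Proof.
by apply: (iffP card_gt0P) => -[y]; rewrite ?inE => xy; exists y; rewrite ?inE.
Qed.

Lemma degree_gt1 x y : 1 < degree e x -> exists2 z, e x z & z != y.
Proof.
case/card_gt1P => a [b [/[!inE] xa xb ne_ab]].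
have [eq_ay|ne_ay] := eqVneq a y; last by exists a.
by exists b; rewrite // -eq_ay eq_sym.
Qed.

Lemma degree_size x s :
  uniq s -> (forall y, e x y = (y \in s)) -> degree e x = size s.
Proof.
move=> uniq_s nbr_x; rewrite -(card_uniqP uniq_s).
by apply: eq_card => y; rewrite inE.
Qed.

Lemma nbr_mem x s : uniq s -> all (e x) s -> degree e x <= size s ->
  forall y, e x y = (y \in s).
Proof.
move=> uniq_s /allP sub_s; rewrite /degree cardE => le_s y.
have [|_ ->] := uniq_min_size uniq_s _ le_s; last by rewrite mem_enum inE.
by move=> z /sub_s; rewrite mem_enum inE.
Qed.

Lemma pendant_nbr x y z : pendant e x -> e x y -> e x z = (z == y).
Proof.
move=> /eqP deg_x xy; rewrite (nbr_mem (s := [:: y])) ?inE //= ?xy //.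
by rewrite deg_x.
Qed.

Lemma quasi_pendantI x y : pendant e y -> e x y -> quasi_pendant e x.
Proof. by move=> py xy; apply/existsP; exists y; rewrite py. Qed.

End Degree.

Section PendantPath.
Variables (T : finType) (e : rel T) (x : T) (p : seq T).
Hypothesis simple_e : simple_graph e.
Hypotheses (path_p : path e x p) (uniq_xp : uniq (x :: p)).
Hypothesis deg_p : {in p, forall y, degree e y <= 2}.
Hypothesis pendant_last : pendant e (last x p).

Let sym_e : symmetric e. Proof. by case: simple_e. Qed.

Lemma pendant_path_nbr i y : i < size p ->
  e (nth x p i) y =
    (y == nth x (x :: p) i) || (i.+1 < size p) && (y == nth x p i.+1).
Proof.
move=> lt_i; have e_prev : e (nth x p i) (nth x (x :: p) i).
  by rewrite sym_e; apply: (pathP x path_p).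
case: ltnP => [lt_i1 | le_i1] /=.
  have e_next : e (nth x p i) (nth x p i.+1) := pathP x path_p _ lt_i1.
  rewrite (nbr_mem (s := [:: nth x (x :: p) i; nth x p i.+1])) ?inE //=.
  - rewrite inE andbT -[nth x p i.+1]/(nth x (x :: p) i.+2).
    by rewrite nth_uniq //=; [rewrite neq_ltn leqnSn | rewrite ltnS ltnW].
  - by rewrite e_prev e_next.
  - exact/deg_p/mem_nth.
have eq_last : nth x p i = last x p.
  by rewrite -nth_last; congr nth; apply/eqP; rewrite eqn_leq; lia.
by rewrite orbF -(pendant_nbr _ _ e_prev) // eq_last.
Qed.

Lemma pendant_path_nbr_in i j : i < size p -> j < size p ->
  e (nth x p i) (nth x p j) = (j == i.+1) || (i == j.+1).
Proof.
move=> lt_i lt_j; have nth_p k : nth x p k = nth x (x :: p) k.+1 by [].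
rewrite pendant_path_nbr // !nth_p nth_uniq /= ?ltnS ?(ltnW lt_i) //.
rewrite orbC [i == _]eq_sym; congr orb; case: ltnP => [lt_i1|le_i1] /=.
  by rewrite !nth_p nth_uniq.
by apply/esym; apply: contraTF lt_j => /eqP ->; rewrite -leqNgt.
Qed.

Lemma pendant_path_nbr_notin i y : i < size p -> y \notin p ->
  e (nth x p i) y = (y == x) && (i == 0).
Proof.
move=> lt_i y_notin_p; have y_neq j : j < size p -> (y == nth x p j) = false.
  by move=> lt_j; apply: contraNF y_notin_p => /eqP ->; apply: mem_nth.
rewrite pendant_path_nbr //; case: i lt_i => [|i] lt_i /=.
  by rewrite andbT; case: ltnP => [/y_neq -> |]; rewrite orbF.
by rewrite andbF y_neq ?(ltnW lt_i) //; case: ltnP => // /y_neq ->.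
Qed.

Lemma has_pendant_pathI : has_pendant_path (size p) e.
Proof.
have [_ irr_e] := simple_e; have [x_notin_p uniq_p] := andP uniq_xp.
pose T1 := {y | y \notin p}; pose e1 : rel T1 := fun v w => e (val v) (val w).
pose u : T1 := exist _ x x_notin_p.
pose f y : T1 + 'I_(size p) :=
  match insub y, insub (index y p) with
  | Some v, _ => inl v | None, Some i => inr i | _, _ => inl u
  end.
pose g (v : T1 + 'I_(size p)) :=
  match v with inl w => val w | inr i => nth x p i end.
have fK : cancel f g.
  rewrite /f => y; case: insubP => [v _ <- //|]; rewrite negbK => p_y.
  by rewrite insubT ?index_mem // => lt_i; rewrite /g /= nth_index.
have gK : cancel g f.
  case=> [v|i]; rewrite /f /g; first by rewrite valK.
  by rewrite insubF ?mem_nth // index_uniq // valK.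
have e_g v w : e (g v) (g w) = attach_path e1 u v w.
  case: v w => [a|i] [b|j] //=; last exact: pendant_path_nbr_in.
    by rewrite sym_e pendant_path_nbr_notin ?(valP a).
  by rewrite pendant_path_nbr_notin ?(valP b).
exists T1, e1, u; split.
  by split=> [v w|v]; [apply: sym_e | apply: irr_e].
by exists f; split=> [|y z]; [exists g | rewrite -e_g !fK].
Qed.

End PendantPath.

Lemma no_pendant_path3_degree (T : finType) (e : rel T) x y z :
    simple_graph e -> ~ has_pendant_path 3 e ->
    pendant e y -> e x y -> degree e x = 2 -> e x z -> z != y ->
  degree e z != 2.
Proof.
move=> [sym_e irr_e] noP3 py xy deg_x xz ne_zy; apply/eqP => deg_z; apply: noP3.
have [u zu ne_ux] : exists2 u, e z u & u != x.
  by apply: degree_gt1; rewrite deg_z.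
have edge_neq a b : e a b -> a != b by apply: contraTneq => ->; rewrite irr_e.
have nbr_y a : e y a = (a == x) by apply: pendant_nbr => //; rewrite sym_e.
have ne_uy : u != y.
  by apply: contraTneq zu => ->; rewrite sym_e nbr_y eq_sym edge_neq.
apply: (@has_pendant_pathI _ e u [:: z; x; y]) => //=.
- by rewrite (sym_e u) zu (sym_e z) xz xy.
- rewrite !inE !negb_or ne_ux ne_uy ne_zy (eq_sym u) (eq_sym z x).
  by rewrite (edge_neq _ _ zu) (edge_neq _ _ xz) (edge_neq _ _ xy).
- move=> a; rewrite !inE => /or3P [] /eqP ->; rewrite ?deg_x ?deg_z //.
  by rewrite (eqP py).
Qed.

(** * Pendant and quasi-pendant vertices *)

Section Connected.
Variables (T : finType) (e : rel T).
Hypotheses (sym_e : symmetric e) (conn_e : forall x y, connect e x y).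

Lemma degree_gt0 x : 1 < #|T| -> 0 < degree e x.
Proof.
rewrite -cardsT => /card_gt1P [a [b [_ _ ne_ab]]].
have [y ne_yx] : exists y, y != x.
  by have [eq_ax|] := eqVneq a x; [exists b; rewrite -eq_ax eq_sym | exists a].
have /connectP [[|z p] /= xp eq_y] := conn_e x y.
  by rewrite eq_y eqxx in ne_yx.
by apply/degree_gt0P; exists z; case/andP: xp.
Qed.

Lemma pendant_not_adjacent x y :
  2 < #|T| -> pendant e x -> pendant e y -> ~~ e x y.
Proof.
rewrite ltnNge => + px py; apply: contra => xy.
have closed_xy : closed e [pred z | z \in [:: x; y]].
  apply: intro_closed; first exact: sym_connect_sym.
  move=> a b ab; rewrite !inE => /orP [] /eqP eq_a; move: ab; rewrite eq_a.
    by rewrite (pendant_nbr _ px xy) => ->; rewrite orbT.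
  by rewrite (pendant_nbr (y := x)) // 1?sym_e // => ->.
rewrite -cardsT; apply: leq_trans (card_size [:: x; y]).
apply/subset_leq_card/subsetP => z _.
by have := closed_connect closed_xy (conn_e x z); rewrite !inE eqxx => <-.
Qed.

Lemma quasi_not_pendant x : 2 < #|T| -> quasi_pendant e x -> ~~ pendant e x.
Proof.
move=> n_gt2 /existsP [y /andP [py xy]].
by apply: contraL xy => px; apply: pendant_not_adjacent.
Qed.

End Connected.

Lemma pendant_of_quasi_uniq (T : finType) (e : rel T) x y z :
    symmetric e -> num_pendant e = num_quasi_pendant e ->
    pendant e y -> pendant e z -> e x y -> e x z ->
  y = z.
Proof.
move=> sym_e pq; pose nbr y := odflt y [pick x | e y x].
have nbrP v w : pendant e w -> e v w -> nbr w = v.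
  rewrite sym_e /nbr => pw wv; case: pickP => [u|/(_ v)]; last by rewrite wv.
  by rewrite (pendant_nbr _ pw wv) => /eqP.
have im_nbr : nbr @: [set w | pendant e w] = [set v | quasi_pendant e v].
  apply/setP => v; rewrite inE; apply/imsetP/existsP => [[w /[!inE] pw ->]|[w]].
    have /degree_gt0P [u wu] : 0 < degree e w by rewrite (eqP pw).
    have uw : e u w by rewrite sym_e.
    by exists w; rewrite pw (nbrP u).
  by case/andP=> pw vw; exists w; rewrite ?inE // (nbrP v).
have /imset_injP nbr_inj :
    #|nbr @: [set w | pendant e w]| == #|[set w | pendant e w]|.
  by rewrite im_nbr; apply/eqP/esym/pq.
by move=> py pz xy xz; apply: nbr_inj; rewrite ?inE // (nbrP x y) ?(nbrP x z).
Qed.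

Definition inner_vertex (T : finType) (e : rel T) : pred T :=
  fun x => ~~ pendant e x && ~~ quasi_pendant e x.

Definition inner_vertices (T : finType) (e : rel T) : {set T} :=
  [set x | inner_vertex e x].

Lemma card_inner_vertices (T : finType) (e : rel T) :
    (forall x, quasi_pendant e x -> ~~ pendant e x) ->
  #|T| = num_pendant e + num_quasi_pendant e + #|inner_vertices e|.
Proof.
move=> quasi_not_pendant.
rewrite -cardsT -(cardsID [set x | pendant e x] [set: T]) setTI -addnA.
congr (_ + _); rewrite -(cardsID [set x | quasi_pendant e x]).
congr (_ + _); apply: eq_card => x; rewrite !inE andbT.
  by rewrite andbC andb_idr //; apply: quasi_not_pendant.
by rewrite andbC.
Qed.

(** * Rooted trees *)

Section SpanningTree.
Variables (T : finType) (e : rel T).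

Lemma shortest_path r x : connect e r x ->
  exists p, [/\ path e r p, last r p = x &
    forall q, path e r q -> last r q = x -> size p <= size q].
Proof.
pose reach n := [exists p : n.-tuple T, path e r p && (last r p == x)].
have reachP n : reflect
    (exists p, [/\ path e r p, last r p = x & size p = n]) (reach n).
  apply: (iffP existsP) => [[p /andP [rp /eqP px]]|[p [rp px /eqP sp]]].
    by exists p; rewrite size_tuple.
  by exists (Tuple sp); rewrite rp px eqxx.
case/connectP => p rp eq_x.
have ex_reach : exists n, reach n by exists (size p); apply/reachP; exists p.
case: (ex_minnP ex_reach) => n /reachP [q [rq qx <-]] min_q; exists q.
by split=> // q' rq' q'x; apply: min_q; apply/reachP; exists q'.
Qed.

Lemma breadth_first_tree r : (forall x, connect e r x) ->
  exists (par : T -> T) (dep : T -> nat),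
    [/\ par r = r, dep r = 0 &
     forall x, x != r -> e (par x) x /\ dep x = (dep (par x)).+1].
Proof.
move=> conn_r.
have [p pP] := fin_all_exists (fun x => shortest_path (conn_r x)).
have p_r : p r = [::].
  by have [_ _ /(_ [::] isT erefl)] := pP r; rewrite leqn0 size_eq0 => /eqP.
exists (fun x => last r (belast r (p x))), (fun x => size (p x)).
split; rewrite ?p_r // => x ne_xr; have [] := pP x.
case/lastP: (p x) => [_ /= eq_rx|q y]; first by rewrite eq_rx eqxx in ne_xr.
rewrite belast_rcons rcons_path last_rcons size_rcons /=.
move=> /andP [rq qy] <- min_q.
have [rq' last_q' min_q'] := pP (last r q); split=> //; congr _.+1.
apply/eqP; rewrite eqn_leq min_q' // andbT.
have := min_q (rcons (p (last r q)) y).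
by rewrite rcons_path rq' last_q' qy last_rcons size_rcons ltnS => ->.
Qed.

Lemma acyclic_spanning_edge (t : rel T) x y :
  acyclic e -> symmetric e -> irreflexive e -> subrel t e ->
  connect t x y -> e x y -> t x y.
Proof.
move=> acyclic_e sym_e irr_e sub_te /connectP [p0].
case/shortenP => p tp uniq_p _ -> {y p0} e_xy.
case: p => [|z [|z' p]] in tp uniq_p e_xy *; first by rewrite /= irr_e in e_xy.
  by case/andP: tp.
(* The path closes up with the edge to a cycle. *)
case: (acyclic_e [:: x, z, z' & p]) => //; apply/andP; split=> //.
by rewrite /cycle rcons_path (sub_path sub_te tp) sym_e.
Qed.

End SpanningTree.

Record rooting (T : finType) (e : rel T) := Rooting {
  tree_root : T;
  parent : T -> T;
  depth : T -> nat;
  parent_root : parent tree_root = tree_root;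
  depth_root : depth tree_root = 0;
  depth_parent : forall x, x != tree_root -> depth x = (depth (parent x)).+1;
  rooted_edge : forall x y,
    e x y = (x != tree_root) && (parent x == y)
         || (y != tree_root) && (parent y == x)
}.

Lemma tree_rooting (T : finType) (e : rel T) (r : T) : is_tree e ->
  exists t : rooting e, tree_root t = r.
Proof.
case=> -[sym_e irr_e] _ conn_e acyclic_e.
have [par [dep [par_r dep_r parP]]] := breadth_first_tree (conn_e r).
pose t := [rel x y | (x != r) && (par x == y) || (y != r) && (par y == x)].
have sym_t : symmetric t by move=> x y; rewrite /= orbC.
have sub_te : subrel t e.
  by move=> x y /orP [] /andP [/parP [e_par _] /eqP <-] //; rewrite sym_e.
have conn_t x : connect t x r.
  have [n le_n] := ubnP (dep x); elim: n => // n IH in x le_n *.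
  have [->|ne_xr] := eqVneq x r; first exact: connect0.
  have [_ dep_x] := parP x ne_xr.
  apply: (@connect_trans _ _ (par x)); first by rewrite connect1 //= ne_xr eqxx.
  by apply: IH; rewrite -ltnS -dep_x.
have edgeE x y : e x y = t x y.
  apply/idP/idP; last exact: sub_te.
  apply: (acyclic_spanning_edge acyclic_e sym_e irr_e sub_te).
  apply: connect_trans (conn_t x) _.
  by rewrite (sym_connect_sym sym_t).
have dep_par x (ne_xr : x != r) := (parP x ne_xr).2.
by exists (Rooting par_r dep_r dep_par edgeE).
Qed.

Section Rooting.
Variables (T : finType) (e : rel T) (t : rooting e).
Implicit Types x y z a b c : T.
Local Notation r := (tree_root t).
Local Notation parent := (parent t).
Local Notation depth := (depth t).

Definition child x y : bool := (y != r) && (parent y == x).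

Lemma child_parent x : x != r -> child (parent x) x.
Proof. by move=> ne_xr; apply/andP. Qed.

Lemma edge_parent x : x != r -> e x (parent x).
Proof. by move=> ne_xr; rewrite (rooted_edge t) ne_xr eqxx. Qed.

Lemma edge_child x y : child x y -> e x y.
Proof. by rewrite (rooted_edge t) orbC /child => ->. Qed.

Lemma child_depth x y : child x y -> depth y = (depth x).+1.
Proof. by case/andP => ne_yr /eqP <-; apply: depth_parent. Qed.

Lemma child_neq x y : child x y -> y != x.
Proof.
by move/child_depth; apply: contra_eq_neq => ->; rewrite neq_ltn leqnn.
Qed.

Lemma child_neq_parent x y : child x y -> x != r -> y != parent x.
Proof.
move=> xy ne_xr; apply: contra_eq_neq (child_depth xy) => ->.
by rewrite (depth_parent ne_xr) neq_ltn ltnS leqW.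
Qed.

Lemma degree_rooted x : degree e x = (x != r) + #|[set y | child x y]|.
Proof.
have [->|ne_xr] := eqVneq x r.
  by apply: eq_card => y; rewrite !inE (rooted_edge t) eqxx.
rewrite /degree (cardsD1 (parent x)) inE edge_parent //; congr (_ + _).
apply: eq_card => y; rewrite !inE (rooted_edge t) ne_xr /= (eq_sym _ y).
rewrite -/(child x y) andb_orr andNb /= andb_idl // => xy.
exact: child_neq_parent.
Qed.

Lemma depth_eq0 x : (depth x == 0) = (x == r).
Proof. by have [->|/depth_parent ->] := eqVneq x r; rewrite ?depth_root. Qed.

Lemma edge_odd_depth x y : e x y -> odd (depth y) = ~~ odd (depth x).
Proof.
rewrite (rooted_edge t) => /orP [/andP [ne_xr /eqP <-]|/child_depth -> //].
by rewrite (depth_parent ne_xr) /= negbK.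
Qed.

Lemma depth_iter i x : depth (iter i parent x) = depth x - i.
Proof.
elim: i => [|i IH]; first by rewrite subn0.
have [eq_r|/depth_parent] := eqVneq (iter i parent x) r.
  by move: IH; rewrite iterS eq_r parent_root depth_root subnS => <-.
by rewrite IH /= subnS => ->.
Qed.

Lemma iter_parent_root i x : depth x <= i -> iter i parent x = r.
Proof. by move=> le_xi; apply/eqP; rewrite -depth_eq0 depth_iter subn_eq0. Qed.

Definition below x a : bool := fconnect parent x a.

Lemma below_refl x : below x x. Proof. exact: connect0. Qed.

Lemma below_trans y x z : below x y -> below y z -> below x z.
Proof. exact: connect_trans. Qed.

Lemma below_parent x : below x (parent x). Proof. exact: fconnect1. Qed.

Lemma below_child x y : child x y -> below y x.
Proof. by case/andP=> _ /eqP <-; apply: below_parent. Qed.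

Lemma below_parentW x a : below x a -> x != a -> below (parent x) a.
Proof. by rewrite /below fconnect_eqVf => /predU1P [-> | //]; rewrite eqxx. Qed.

Lemma below_iter x a : below x a -> a = iter (depth x - depth a) parent x.
Proof.
move/iter_findex; move: (findex _ _ _) => i <-; rewrite depth_iter.
have [le_i|lt_i] := leqP i (depth x); first by rewrite subKn.
by rewrite !iter_parent_root //; lia.
Qed.

Lemma below_depth_inj x a b :
  below x a -> below x b -> depth a = depth b -> a = b.
Proof. by move=> xa xb ab; rewrite (below_iter xa) ab -(below_iter xb). Qed.

Lemma below_depth x a : below x a -> depth a <= depth x.
Proof. by move/below_iter ->; rewrite depth_iter leq_subr. Qed.

Lemma below_root x : below x r.
Proof.
by rewrite -(iter_parent_root (leqnn (depth x))); apply: fconnect_iter.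
Qed.

Lemma below_children_inj x c c' d :
  child x c -> child x c' -> below d c -> below d c' -> c = c'.
Proof.
move=> xc xc' dc dc'; apply: below_depth_inj dc dc' _.
by rewrite (child_depth xc) (child_depth xc').
Qed.

Lemma lowest_below (P : pred T) x : P x ->
  exists y, [/\ below y x, P y & forall z, below z y -> P z -> z = y].
Proof.
move=> Px; have Bx : below x x && P x by rewrite below_refl.
case: (@arg_maxnP _ x (fun y => below y x && P y) depth Bx).
move=> y /andP [yx Py] max_y; exists y; split=> // z zy Pz.
apply: (below_depth_inj (below_refl z) zy).
apply/eqP; rewrite eqn_leq (below_depth zy) andbT.
by apply: max_y; rewrite Pz andbT (below_trans zy yx).
Qed.

Lemma pendant_no_child x y : x != r -> pendant e x -> ~~ child x y.
Proof.
move=> ne_xr /eqP; rewrite degree_rooted ne_xr => -[] /eqP.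
by rewrite cards_eq0 => /eqP/setP/(_ y); rewrite !inE => /negbT.
Qed.

End Rooting.

(** * Isomorphisms and the trees [Tk k] *)

Lemma lap_eigenfun_iso (R : comNzRingType) (T1 T2 : finType) (e1 : rel T1)
    (e2 : rel T2) (f : T1 -> T2) (a : R) (phi : T2 -> R) :
    bijective f -> (forall x y, e1 x y = e2 (f x) (f y)) ->
  lap_eigenfun e2 a phi -> lap_eigenfun e1 a (phi \o f).
Proof.
move=> bij_f iso_f eig x; rewrite -[RHS]eig (reindex f) /=; last exact: onW_bij.
by apply: eq_bigl => y; rewrite iso_f.
Qed.

Lemma graph_iso_codes (P : eqType) (adj : rel P) (T1 T2 : finType)
    (e1 : rel T1) (e2 : rel T2) (code1 : T1 -> P) (code2 : T2 -> P) :
    injective code1 -> injective code2 -> codom code1 =i codom code2 ->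
    (forall x y, e1 x y = adj (code1 x) (code1 y)) ->
    (forall x y, e2 x y = adj (code2 x) (code2 y)) ->
  graph_iso e1 e2.
Proof.
move=> inj1 inj2 eq_codom adj1 adj2.
have code1P x : code1 x \in codom code2 by rewrite -eq_codom codom_f.
have code2P x : code2 x \in codom code1 by rewrite eq_codom codom_f.
exists (fun x => iinv (code1P x)); split=> [|x y]; last by rewrite adj2 !f_iinv.
exists (fun x => iinv (code2P x)) => x; first by apply: inj1; rewrite !f_iinv.
by apply: inj2; rewrite !f_iinv.
Qed.

(* The infinite comb: a path on the natural numbers, its vertices coded
   [(false, i)], with a pendant vertex [(true, i)] attached to each of them.
   Deleting the pendant vertices of [Tk k] leaves a path, so that [Tk k] is a
   subgraph of the comb. *)
Definition comb : rel (bool * nat) := fun p q =>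
  [&& ~~ p.1, ~~ q.1 & (p.2 == q.2.+1) || (q.2 == p.2.+1)]
  || (p.1 != q.1) && (p.2 == q.2).

Section TkComb.
Variable k : nat.
Implicit Types v w : Tk_vertex k.

Definition Tk_comb_pos v : bool * nat :=
  match v with
  | TC i => (false, 3 * i + 1) | TD i => (true, 3 * i + 1)
  | TA i => (false, 3 * i + 2) | TB i => (false, 3 * i + 3)
  | TX1 => (false, 0) | TX2 => (true, 0)
  | TY1 => (false, 3 * k + 2) | TY2 => (true, 3 * k + 2)
  end.

Lemma Tk_comb_pos_inj : injective Tk_comb_pos.
Proof.
by case=> [i|i|i|i||||] [j|j|j|j||||] //= [] ?;
  try (congr (_ _); apply: val_inj => /=);
  try (have := ltn_ord i); try (have := ltn_ord j); lia.
Qed.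

Lemma codom_Tk_comb_pos (p : bool * nat) : (p \in codom Tk_comb_pos) =
  (p.2 <= 3 * k + 2) &&
  (p.1 ==> [|| p.2 == 0, p.2 == 3 * k + 2 | p.2 %% 3 == 1]).
Proof.
apply/codomP/idP => [[v ->]|].
  by case: v => [i|i|i|i||||] /=; try (have := ltn_ord i); lia.
case: p => b i /= /andP [le_i pend_i].
have [eq_i|ne_i0] := eqVneq i 0.
  by case: b {pend_i}; [exists TX2 | exists TX1]; rewrite eq_i.
have [eq_i|ne_ik] := eqVneq i (3 * k + 2).
  by case: b {pend_i}; [exists TY2 | exists TY1]; rewrite eq_i.
have [eq_i|ne_i1] := eqVneq (i %% 3) 1.
  have lt_i : i %/ 3 < k.+1 by lia.
  by case: b {pend_i};
    [exists (TD (Ordinal lt_i)) | exists (TC (Ordinal lt_i))];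
    congr pair => /=; lia.
have lt_i : i.-1 %/ 3 < k by lia.
case: b pend_i => [|_] /=.
  by rewrite (negPf ne_i0) (negPf ne_ik) (negPf ne_i1).
have [eq_i|ne_i2] := eqVneq (i %% 3) 2.
  by exists (TA (Ordinal lt_i)); congr pair => /=; lia.
by exists (TB (Ordinal lt_i)); congr pair => /=; lia.
Qed.

Lemma Tk_comb_adj v w : Tk v w = comb (Tk_comb_pos v) (Tk_comb_pos w).
Proof.
case: v => [i|i|i|i||||]; case: w => [j|j|j|j||||];
  rewrite /Tk /comb /= -?val_eqE /= ?orbF ?andbF ?orbT //;
  try (have := ltn_ord i); try (have := ltn_ord j); lia.
Qed.

Let left_index (i : 'I_k) : 'I_k.+1 := widen_ord (leqnSn k) i.
Let right_index (i : 'I_k) : 'I_k.+1 := lift ord0 i.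

Lemma degree_TD (i : 'I_k.+1) : degree (@Tk k) (TD i) = 1.
Proof.
apply: (degree_size (s := [:: TC i])) => // w.
rewrite inE Tk_comb_adj -(inj_eq Tk_comb_pos_inj).
by case: w => [j|j|j|j||||]; rewrite /comb /= xpair_eqE /=; lia.
Qed.

Lemma degree_TA (i : 'I_k) : degree (@Tk k) (TA i) = 2.
Proof.
apply: (degree_size (s := [:: TC (left_index i); TB i])) => // w.
rewrite !inE Tk_comb_adj -!(inj_eq Tk_comb_pos_inj); have := ltn_ord i.
by case: w => [j|j|j|j||||]; rewrite /comb /= !xpair_eqE /=; lia.
Qed.

Lemma degree_TB (i : 'I_k) : degree (@Tk k) (TB i) = 2.
Proof.
apply: (degree_size (s := [:: TA i; TC (right_index i)])) => // w.
rewrite !inE Tk_comb_adj -!(inj_eq Tk_comb_pos_inj); have := ltn_ord i.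
by case: w => [j|j|j|j||||]; rewrite /comb /= !xpair_eqE /= /bump /=; lia.
Qed.

Local Open Scope ring_scope.
Variable R : comNzRingType.

Definition Tk_eigenfun (i : 'I_k) (v : Tk_vertex k) : R :=
  (v == TA i)%:R + (v == TB i)%:R
  - (v == TD (left_index i))%:R - (v == TD (right_index i))%:R.

Lemma Tk_eigenfunP i : lap_eigenfun (@Tk k) 1 (Tk_eigenfun i).
Proof.
apply/lap_eigenfunE => v; rewrite !sumrB big_split /=.
have sum_delta w : \sum_(x | Tk v x) (x == w)%:R = (Tk v w)%:R :> R.
  have [vw|nvw] := boolP (Tk v w).
    by rewrite (bigD1 w) //= eqxx big1 ?addr0 // => x /andP [_ /negPf ->].
  by rewrite big1 // => x vx; case: eqP => // eq_x; rewrite -eq_x vx in nvw.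
rewrite !{}sum_delta /Tk_eigenfun.
have eqTA j : (TA j == TA i) = (j == i) by apply: inj_eq => ? ? [].
have eqTB j : (TB j == TB i) = (j == i) by apply: inj_eq => ? ? [].
case: v => [j|j|j|j||||];
  rewrite ?degree_TD ?degree_TA ?degree_TB ?eqTA ?eqTB /Tk /=.
all: rewrite ?orbF -?val_eqE /= ?add1n 1?[i == j :> nat]eq_sym; ring.
Qed.

Lemma Tk_eigenfun_TA i j : Tk_eigenfun i (TA j) = (i == j)%:R.
Proof.
have eqTA : (TA j == TA i) = (j == i) by apply: inj_eq => ? ? [].
by rewrite /Tk_eigenfun eqTA eq_sym !subr0 addr0.
Qed.

End TkComb.

Lemma Tk_sym k : symmetric (@Tk k).
Proof. by move=> v w; rewrite /Tk orbC. Qed.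

Lemma eigen_mult_iso_Tk (F : realFieldType) (T : finType) (e : rel T) k :
    graph_iso e (@Tk k) ->
  (k <= eigen_mult (laplacian F e) 1)%N /\ #|T| = (4 * k + 6)%N.
Proof.
case=> f [bij_f iso_f]; have [g fK gK] := bij_f; split.
  apply: (@eigen_mult_ge_family _ _ e _ 1 k
    (fun i => Tk_eigenfun F i \o f) (g \o @TA k)).
  - by move=> x y; rewrite !iso_f Tk_sym.
  - by move=> i; apply: lap_eigenfun_iso bij_f iso_f (Tk_eigenfunP F i).
  - by move=> i j; rewrite /= gK Tk_eigenfun_TA.
by rewrite (bij_eq_card bij_f) card_Tk.
Qed.

(** * Trees with as many pendant as quasi-pendant vertices *)

Lemma divn_offset d a n : 0 < d -> a <= n ->
  exists q s, s < d /\ n = d * q + (s + a).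
Proof.
move=> d_gt0 le_an; exists ((n - a) %/ d), ((n - a) %% d).
by rewrite ltn_pmod // addnA mulnC -divn_eq subnK.
Qed.

Section PendantMatchedTree.
Variables (T : finType) (e : rel T).
Hypotheses (tree_e : is_tree e) (n_gt2 : 2 < #|T|).
Hypothesis pq : num_pendant e = num_quasi_pendant e.
Implicit Types x y z u w c d : T.
Local Notation inner := (inner_vertex e).
Local Notation inner_vertices := (inner_vertices e).
Local Notation quasi := (quasi_pendant e).

Let simple_e : simple_graph e. Proof. by case: tree_e. Qed.
Let sym_e : symmetric e. Proof. by case: simple_e. Qed.
Let conn_e x y : connect e x y. Proof. by case: tree_e. Qed.
Let deg_gt0 x : 0 < degree e x. Proof. exact: degree_gt0 (ltnW n_gt2). Qed.
Let quasiNpendant x : quasi x -> ~~ pendant e x.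
Proof. exact: quasi_not_pendant. Qed.

Lemma inner_quasi x : inner x -> quasi x = false.
Proof. by case/andP => _ /negPf. Qed.

Lemma quasi_inner x : quasi x -> ~~ inner x.
Proof. by move=> qx; rewrite /inner_vertex qx andbF. Qed.

Lemma not_pendantE x : ~~ pendant e x = inner x || quasi x.
Proof.
rewrite /inner_vertex; have [qx|_] := boolP (quasi x).
  by rewrite orbT quasiNpendant.
by rewrite andbT orbF.
Qed.

Lemma inner_not_pendant x : inner x -> ~~ pendant e x.
Proof. by case/andP. Qed.

Lemma inner_nbr x y : inner x -> e x y -> inner y || quasi y.
Proof.
move=> inner_x xy; rewrite -not_pendantE.
apply: contraFN (inner_quasi inner_x) => py.
exact: quasi_pendantI py xy.
Qed.

Lemma inner_degree x : inner x -> 1 < degree e x.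
Proof. by case/andP => np _; rewrite ltn_neqAle eq_sym deg_gt0 andbT. Qed.

Variable t : rooting e.
Local Notation r := (tree_root t).
Local Notation parent := (parent t).
Local Notation depth := (depth t).
Local Notation child := (child t).
Local Notation below := (below t).

Lemma has_child x : (x == r) || ~~ pendant e x -> exists y, child x y.
Proof.
move=> x_r; suff /card_gt0P [y] : 0 < #|[set y | child x y]|.
  by rewrite inE; exists y.
have := deg_gt0 x; move: x_r; rewrite /pendant (degree_rooted t).
by case: eqVneq => //= _; case: #|_|.
Qed.

Lemma lowest_quasi_pendant x : (x == r) || ~~ pendant e x ->
  exists u y, [/\ below u x, pendant e y, child u y & degree e u = (u != r).+1].
Proof.
move=> x_r; have [u [ux u_r low_u]] :=
  lowest_below t (P := fun z => (z == r) || ~~ pendant e z) x_r.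
have pendant_child c : child u c -> pendant e c.
  move=> uc; apply: contraTT (child_neq uc) => npc; rewrite negbK.
  by apply/eqP/low_u; [apply: below_child | rewrite npc orbT].
have [y uy] := has_child u_r.
exists u, y; split=> //; first exact: pendant_child.
rewrite (degree_rooted t) -addn1 -(cards1 y); congr (_ + _).
apply: eq_card => z; rewrite in_set1 inE; apply/idP/eqP => [uz|->//].
exact: pendant_of_quasi_uniq sym_e pq (pendant_child z uz) (pendant_child y uy)
  (edge_child uz) (edge_child uy).
Qed.

Hypothesis n_gt5 : 5 < #|T|.
Hypotheses (quasi_r : quasi r) (degree_r : degree e r = 2).
Hypothesis noP3 : ~ has_pendant_path 3 e.

Lemma pendant_neq_root x : pendant e x -> x != r.
Proof. by apply: contraTneq => ->; apply: quasiNpendant. Qed.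

Lemma inner_neq_root x : inner x -> x != r.
Proof. by apply: contraTneq => ->; apply: quasi_inner. Qed.

Lemma parent_not_pendant x : x != r -> ~~ pendant e (parent x).
Proof.
move=> ne_xr; apply/negP => pp.
by have := pendant_no_child x (pendant_neq_root pp) pp; rewrite child_parent.
Qed.

Lemma pendant_parent_not_pendant y : pendant e y -> ~~ pendant e (parent y).
Proof. by move=> py; apply/parent_not_pendant/pendant_neq_root. Qed.

Lemma not_pendant_child x : ~~ pendant e x -> exists y, child x y.
Proof. by move=> np; apply: has_child; rewrite np orbT. Qed.

Lemma pendant_nbr_parent x y : pendant e y -> e x y = (x == parent y).
Proof.
move=> py; rewrite sym_e.
exact/(pendant_nbr _ py)/edge_parent/pendant_neq_root.
Qed.

Lemma root_not_pendant_child : exists w, [/\ child r w, ~~ pendant e w &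
  forall c, child r c -> ~~ pendant e c -> c = w].
Proof.
have [y /andP [py ry]] := existsP quasi_r.
have cy : child r y by move: ry; rewrite (rooted_edge t) eqxx.
move: degree_r; rewrite (degree_rooted t) eqxx (cardsD1 y) inE cy => -[] /eqP.
case/cards1P => w /setP def_w; exists w.
have := def_w w; rewrite !inE eqxx => /andP [ne_wy rw]; split=> // [|c rc npc].
  apply: contra ne_wy => pw; apply/eqP.
  exact: (pendant_of_quasi_uniq sym_e pq pw py (edge_child rw) ry).
apply/set1P; rewrite -def_w !inE rc andbT.
by apply: contraNneq npc => ->.
Qed.

Lemma below_root_child w x : child r w -> below w x -> x != r -> x = w.
Proof.
move=> rw wx ne_xr; apply/esym; apply: (below_depth_inj (below_refl t w) wx).
have := below_depth wx; rewrite (child_depth rw) depth_root.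
by have := depth_eq0 t x; rewrite (negPf ne_xr); lia.
Qed.

Lemma below_sole_root_child w x :
    (forall c, child r c -> ~~ pendant e c -> c = w) ->
  x != r -> ~~ pendant e x -> below x w.
Proof.
move=> uniq_w; have [n] := ubnP (depth x).
elim: n x => // n IH x lt_n ne_xr npx.
have [px|ne_pr] := eqVneq (parent x) r.
  by rewrite (uniq_w x) ?below_refl // -px child_parent.
apply: below_trans (below_parent t x) _.
apply: IH ne_pr (parent_not_pendant ne_xr).
by rewrite -ltnS -depth_parent.
Qed.

(** * Counting quasi-pendant vertices *)

Definition inner_leaves : {set T} :=
  [set x | inner x && [forall c, child x c ==> ~~ inner c]].

Definition inner_branchings : {set T} :=
  [set x | [&& inner x, 2 < degree e x & [exists c, child x c && quasi c]]].

Definition quasi_under (P : pred T) : {set T} :=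
  [set u | [&& quasi u, u != r & P (parent u)]].

Definition anchors : {set T} := inner_branchings :|: quasi_under quasi.

Lemma inner_leafP x : reflect
  (inner x /\ forall c, child x c -> quasi c) (x \in inner_leaves).
Proof.
rewrite inE; apply: (iffP andP) => -[inner_x chx]; split=> //.
  move=> c xc; have := inner_nbr inner_x (edge_child xc).
  by have := forallP chx c; rewrite xc => /negPf ->.
by apply/forallP => c; apply/implyP => /chx /quasi_inner.
Qed.

Lemma parent_not_inner_leaf x : inner x -> parent x \notin inner_leaves.
Proof.
move=> inner_x; apply/inner_leafP => -[_ /(_ x)].
by rewrite child_parent ?inner_neq_root // inner_quasi // => /(_ isT).
Qed.

Lemma card_vertices : #|T| = (num_quasi_pendant e).*2 + #|inner_vertices|.
Proof. by rewrite (card_inner_vertices quasiNpendant) pq addnn. Qed.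

Lemma card_quasi :
  num_quasi_pendant e = (#|quasi_under inner| + #|quasi_under quasi|).+1.
Proof.
rewrite /num_quasi_pendant (cardsD1 r) inE quasi_r add1n; congr _.+1.
rewrite -(cardsID [set u | inner (parent u)]).
congr (_ + _); apply: eq_card => u.
  by rewrite !inE -andbA andbCA.
rewrite !inE; have [|ne_ur] := eqVneq u r; rewrite ?andbF //=.
have := parent_not_pendant ne_ur; rewrite not_pendantE andbC.
by have [/inner_quasi -> _|_ /= ->] := boolP (inner (parent u)).
Qed.

Lemma leq_quasi_children x : (x \in inner_leaves) + (x \in inner_branchings)
  <= #|[set u in quasi_under inner | parent u == x]|.
Proof.
have [inner_x|not_inner_x] := boolP (inner x); last first.
  by rewrite !inE (negPf not_inner_x).
have -> : [set u in quasi_under inner | parent u == x] =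
    [set c | child x c && quasi c].
  apply/setP => u; rewrite !inE /child.
  by case: (parent u =P x) => [->|_]; rewrite ?andbF // inner_x !andbT andbC.
have [/inner_leafP [_ chx]|_] := boolP (x \in inner_leaves).
  have -> : [set c | child x c && quasi c] = [set c | child x c].
    by apply/setP => c; rewrite !inE andb_idr //; apply: chx.
  have := inner_degree inner_x.
  have [/[!inE] /and3P [_ + _]|_] := boolP (x \in inner_branchings);
    by rewrite (degree_rooted t) inner_neq_root //=; lia.
have [|//] := boolP (x \in inner_branchings).
rewrite inE => /and3P [_ _ /existsP [c xc]].
by apply/card_gt0P; exists c; rewrite inE.
Qed.

Lemma card_leaves_branchings :
  #|inner_leaves| + #|inner_branchings| <= #|quasi_under inner|.
Proof.
have card_sum (A : {set T}) : #|A| = \sum_x (x \in A).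
  by rewrite -sum1_card big_mkcond; apply: eq_bigr => x _; case: (x \in A).
rewrite [#|inner_leaves|]card_sum [#|inner_branchings|]card_sum -big_split /=.
rewrite -[leqRHS]sum1_card [leqRHS](partition_big parent predT) //=.
by apply: leq_sum => x _; rewrite sum1dep_card leq_quasi_children.
Qed.

Lemma leaves_anchors_lt_quasi :
  #|inner_leaves| + #|anchors| < num_quasi_pendant e.
Proof.
have [+ _] := leq_card_setU inner_branchings (quasi_under quasi).
by rewrite card_quasi -/anchors; have := card_leaves_branchings; lia.
Qed.

(* A lowest non-pendant vertex below [x] has degree two; if its parent were an
   inner vertex of degree two, both would lie on a pendant [P_3]. *)
Lemma exists_quasi_below x : x != r -> ~~ pendant e x ->
  exists u, [/\ below u x, quasi u, u != r &
    quasi (parent u) \/ inner (parent u) /\ 2 < degree e (parent u)].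
Proof.
move=> ne_xr npx.
have [|u [y [ux py uy deg_u]]] := lowest_quasi_pendant (x := x).
  by rewrite npx orbT.
have ne_ur : u != r.
  apply: contraNneq ne_xr => eq_ur; rewrite -(depth_eq0 t) -leqn0.
  by rewrite -(depth_root t) -[tree_root t]eq_ur below_depth.
have e_uy := edge_child uy; rewrite ne_ur in deg_u.
exists u; split=> //; first exact: quasi_pendantI py e_uy.
have ne_py : parent u != y by rewrite eq_sym (child_neq_parent uy).
have deg_p :=
  no_pendant_path3_degree simple_e noP3 py e_uy deg_u (edge_parent ne_ur) ne_py.
have := parent_not_pendant ne_ur; rewrite not_pendantE.
case/orP => [inner_p|]; [right; split=> // | by left].
by rewrite ltn_neqAle eq_sym deg_p inner_degree.
Qed.

Lemma anchor_below x : inner x -> exists2 d, d \in anchors & below d x.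
Proof.
move=> inner_x; have [u [ux qu ne_ur]] :=
  exists_quasi_below (inner_neq_root inner_x) (inner_not_pendant inner_x).
case=> [qp|[inner_p deg_p]].
  by exists u; rewrite // !inE qu ne_ur qp orbT.
exists (parent u); last first.
  by apply: below_parentW ux (contraTneq _ qu) => ->; rewrite inner_quasi.
rewrite in_setU inE inner_p deg_p; apply/orP; left; apply/existsP; exists u.
by rewrite child_parent.
Qed.

Lemma root_child_degree w : child r w -> inner w -> 2 < degree e w.
Proof.
move=> rw inner_w; have [y /andP [py ry]] := existsP quasi_r.
have ne_wy : w != y.
  by apply: contraTneq inner_w => ->; rewrite /inner_vertex py.
rewrite ltn_neqAle eq_sym inner_degree // andbT.
exact: no_pendant_path3_degree simple_e noP3 py ry degree_r (edge_child rw)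
  ne_wy.
Qed.

Lemma quasi_under_quasi_gt1 : #|inner_vertices| = 0 -> 1 < #|quasi_under quasi|.
Proof.
move=> card0; have := card_vertices; rewrite card0 card_quasi.
rewrite (_ : #|quasi_under inner| = 0); first by lia.
move/eqP: card0; rewrite cards_eq0 => /eqP/setP no_inner.
apply/eqP; rewrite cards_eq0; apply/eqP/setP => u.
by have := no_inner (parent u); rewrite !inE => ->; rewrite !andbF.
Qed.

Lemma anchors_gt1_root_child w : child r w -> w \in anchors ->
  #|inner_vertices| = 1 \/ 1 < #|anchors|.
Proof.
move=> rw anchor_w; have [/existsP [z /andP [inner_z ne_zw]]|no_inner] :=
  boolP [exists z, inner z && (z != w)].
  have [d anchor_d dz] := anchor_below inner_z; right.
  apply/card_gt1P; exists w, d; split=> //.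
  apply: contra_neq ne_zw => eq_wd; rewrite -{}eq_wd in dz.
  by apply: below_root_child rw dz (inner_neq_root inner_z).
have sub_w : inner_vertices \subset [set w].
  apply/subsetP => z; rewrite !inE => inner_z.
  apply: contraNT no_inner => ne_zw.
  by apply/existsP; exists z; rewrite inner_z.
move: (subset_leq_card sub_w); rewrite cards1 leq_eqVlt ltnS leqn0.
case/orP=> /eqP; [by left | move/quasi_under_quasi_gt1=> gt1; right].
exact: leq_trans gt1 (subset_leq_card (subsetUr _ _)).
Qed.

Lemma anchors_gt1_inner_children x c c' :
    child x c -> child x c' -> inner c -> inner c' -> c != c' ->
  1 < #|anchors|.
Proof.
move=> xc xc' inner_c inner_c' ne_cc'.
have [d anchor_d dc] := anchor_below inner_c.
have [d' anchor_d' dc'] := anchor_below inner_c'.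
apply/card_gt1P; exists d, d'; split=> //; apply: contra_neq ne_cc' => eq_d.
by apply: below_children_inj xc xc' dc _; rewrite eq_d.
Qed.

Lemma anchors_gt1 : #|inner_vertices| = 1 \/ 1 < #|anchors|.
Proof.
have [w [rw npw _]] := root_not_pendant_child.
have [ne_wr /eqP par_w] := andP rw.
have [/(anchors_gt1_root_child rw) //|] := boolP (w \in anchors).
rewrite !inE ne_wr par_w quasi_r !andbT negb_or => /andP [no_branch nqw]; right.
have inner_w : inner w by rewrite /inner_vertex npw.
have deg_w := root_child_degree rw inner_w.
have inner_child c : child w c -> inner c.
  move=> wc; have /orP [//|qc] := inner_nbr inner_w (edge_child wc).
  case/negP: no_branch; rewrite inner_w deg_w; apply/existsP; exists c.
  by rewrite wc.
have /card_gt1P [c [c' [/[!inE] wc wc' ne_cc']]] : 1 < #|[set c | child w c]|.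
  by move: deg_w; rewrite (degree_rooted t) ne_wr.
exact: anchors_gt1_inner_children wc wc' (inner_child c wc) (inner_child c' wc')
  ne_cc'.
Qed.

(** * The eigenvalue 1 *)

Section Eigenvalue1.
Variable F : realFieldType.
Local Notation m := (eigen_mult (laplacian F e) 1%R).

Section Eigenfunction.
Local Open Scope ring_scope.
Variable f : T -> F.
Hypothesis eig_f : lap_eigenfun e 1 f.

Lemma eigenfun_quasi_eq0 u : quasi u -> f u = 0.
Proof.
case/existsP => y /andP [py]; rewrite sym_e => yu.
rewrite (lap_eigenfun_nbr eig_f yu) ?(eqP py) ?subrr ?mul0r // => x.
by rewrite (pendant_nbr _ py yu) => ->.
Qed.

Lemma eigenfun_isolated_eq0 x :
  inner x -> (forall w, e x w -> f w = 0) -> f x = 0.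
Proof.
move=> inner_x f0; have /eqP := (lap_eigenfunE _ _ _).1 eig_f x.
rewrite big1 // eq_sym mulf_eq0 subr_eq0 pnatr_eq1 => /orP [deg1|/eqP //].
by have := inner_degree inner_x; rewrite (eqP deg1).
Qed.

Lemma eigenfun_parent_eq0 x c : child x c -> f c = 0 ->
  (forall y, child c y -> f y = 0) -> f x = 0.
Proof.
move=> xc fc fy; have cx : e c x by rewrite sym_e (edge_child xc).
rewrite (lap_eigenfun_nbr eig_f cx) ?fc ?mulr0 // => y.
rewrite (rooted_edge t) => /orP [/andP [_ /eqP <-]|/fy //].
by case/andP: xc => _ ->.
Qed.

Lemma eigenfun_above_leaves_eq0 x : inner x ->
  (forall z, z \in inner_leaves -> below z x -> f z = 0) -> f x = 0.
Proof.
move=> inner_x leaf0; apply/eqP/negPn/negP => fx_neq0.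
have [|y [yx /andP [inner_y fy_neq0] low_y]] :=
  lowest_below t (P := fun z => inner z && (f z != 0)) (x := x).
  by rewrite inner_x.
have below0 z : below z y -> z != y -> inner z -> f z = 0.
  move=> zy ne_zy inner_z; apply: contraNeq ne_zy => fz.
  by apply/eqP/low_y; rewrite ?inner_z.
have [c yc inner_c] : exists2 c, child y c & inner c.
  have : y \notin inner_leaves by apply: contra fy_neq0 => /leaf0 ->.
  rewrite inE inner_y negb_forall => /existsP [c].
  by rewrite negb_imply negbK => /andP []; exists c.
case/eqP: fy_neq0; apply: (eigenfun_parent_eq0 yc).
  exact: below0 (below_child yc) (child_neq yc) inner_c.
move=> d cd.
have /orP [inner_d|/eigenfun_quasi_eq0 //] := inner_nbr inner_c (edge_child cd).
apply: below0 inner_d.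
  exact: below_trans (below_child cd) (below_child yc).
apply: contra_eq_neq (child_depth cd) => ->.
by rewrite (child_depth yc) neq_ltn leqW.
Qed.

End Eigenfunction.

Lemma inner_vertices_forcing : forcing_set e (1%R : F) inner_vertices.
Proof.
move=> f eig_f f0; have not_pendant_eq0 x : ~~ pendant e x -> f x = 0%R.
  rewrite not_pendantE => /orP [inner_x|/(eigenfun_quasi_eq0 eig_f) //].
  by apply: f0; rewrite inE.
move=> x; have [px|/not_pendant_eq0 //] := boolP (pendant e x).
have /degree_gt0P [u xu] := deg_gt0 x; have ux : e u x by rewrite sym_e.
rewrite (lap_eigenfun_nbr eig_f ux) => [|y uy ne_yx].
  by rewrite (eigenfun_quasi_eq0 eig_f (quasi_pendantI px ux)) mulr0.
apply: not_pendant_eq0; apply: contra ne_yx => py.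
by rewrite (pendant_of_quasi_uniq sym_e pq py px uy ux).
Qed.

Lemma inner_leaves_forcing : forcing_set e (1%R : F) inner_leaves.
Proof.
move=> f eig_f f0; apply: inner_vertices_forcing => // x.
rewrite inE => inner_x.
by apply: (eigenfun_above_leaves_eq0 eig_f) => // z /f0.
Qed.

(* Inner vertices of equal depth parity are pairwise nonadjacent. *)
Lemma inner_parity_forcing b :
  forcing_set e (1%R : F) [set x in inner_vertices | odd (depth x) == b].
Proof.
move=> f eig_f f0; apply: inner_vertices_forcing => // x.
rewrite inE => inner_x.
have [odd_x|odd_x] := eqVneq (odd (depth x)) b.
  by apply: f0; rewrite !inE inner_x odd_x /=.
apply: (eigenfun_isolated_eq0 eig_f) => // w xw.
have /orP [inner_w|/(eigenfun_quasi_eq0 eig_f) //] := inner_nbr inner_x xw.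
apply: f0; rewrite !inE inner_w (edge_odd_depth t xw) /=.
by case: b (odd _) odd_x => -[].
Qed.

Lemma eigen_mult_le_leaves : m <= #|inner_leaves|.
Proof. exact: eigen_mult_le_forcing sym_e _ _ inner_leaves_forcing. Qed.

Lemma double_eigen_mult_le_inner : m.*2 <= #|inner_vertices|.
Proof.
have le_parity b : m <= #|[set x in inner_vertices | odd (depth x) == b]|.
  exact: eigen_mult_le_forcing sym_e _ _ (@inner_parity_forcing b).
rewrite -addnn -(cardsID [set x | odd (depth x)] inner_vertices) leq_add //.
  rewrite (leq_trans (le_parity true)) //; apply/subset_leq_card/subsetP => x.
  by rewrite !inE eqb_id.
rewrite (leq_trans (le_parity false)) //; apply/subset_leq_card/subsetP => x.
by rewrite !inE eqbF_neg andbC.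
Qed.

Lemma eigen_mult_bound : 4 * m + 6 <= #|T|.
Proof.
have := card_vertices; have := leaves_anchors_lt_quasi; have := anchors_gt1.
have := eigen_mult_le_leaves; have := double_eigen_mult_le_inner.
by move: n_gt5; lia.
Qed.

Lemma leaf_parent_value (f : T -> F) z :
    lap_eigenfun e 1 f -> z \in inner_leaves ->
  (f (parent z) = ((degree e z)%:R - 1) * f z)%R.
Proof.
move=> eig_f /inner_leafP [inner_z chz].
apply: (lap_eigenfun_nbr eig_f (edge_parent (inner_neq_root inner_z))) => x.
rewrite (rooted_edge t) => /orP [/andP [_ /eqP <-]|]; first by rewrite eqxx.
by move/chz/(eigenfun_quasi_eq0 eig_f).
Qed.

Section TightLeaves.
Hypothesis mult_leaves : m = #|inner_leaves|.

Lemma leaf_eigenfun z : z \in inner_leaves ->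
  exists f : T -> F, [/\ lap_eigenfun e 1 f, f z = 1%R, f (parent z) != 0%R &
    {in inner_leaves, forall y, y != z -> f y = 0%R}].
Proof.
move=> leaf_z; have [f [eig_f fz f0]] :=
  forcing_interpolation sym_e inner_leaves_forcing mult_leaves leaf_z.
exists f; split=> //.
rewrite (leaf_parent_value eig_f) // fz mulr1 subr_eq0 pnatr_eq1.
by have [inner_z _] := inner_leafP _ leaf_z; rewrite neq_ltn inner_degree ?orbT.
Qed.

Lemma leaf_parent_inner z : z \in inner_leaves -> inner (parent z).
Proof.
move=> leaf_z; have [f [eig_f _ fp_neq0 _]] := leaf_eigenfun leaf_z.
have [inner_z _] := inner_leafP _ leaf_z.
have /orP [//|] := inner_nbr inner_z (edge_parent (inner_neq_root inner_z)).
by move/(eigenfun_quasi_eq0 eig_f) => fp0; rewrite fp0 eqxx in fp_neq0.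
Qed.

Lemma leaf_inner_sibling z c :
  z \in inner_leaves -> child (parent z) c -> inner c -> c = z.
Proof.
move=> leaf_z pc inner_c; have [f [eig_f _ fp_neq0 f0]] := leaf_eigenfun leaf_z.
have [inner_z _] := inner_leafP _ leaf_z.
have pz := child_parent (inner_neq_root inner_z).
apply/eqP; apply: contraNT fp_neq0 => ne_cz; apply/eqP.
have below0 y : below y c -> inner y -> f y = 0%R.
  move=> yc inner_y; apply: (eigenfun_above_leaves_eq0 eig_f) => //.
  move=> z' leaf_z' z'y.
  apply: f0 => //; apply: contra_neq ne_cz => eq_z'; rewrite eq_z' in z'y.
  exact: below_children_inj pc pz (below_trans z'y yc) (below_refl _ _).
have fc : f c = 0%R by apply: below0 => //; apply: below_refl.
apply: (eigenfun_parent_eq0 eig_f pc fc) => y cy.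
have := inner_nbr inner_c (edge_child cy).
case/orP=> [|/(eigenfun_quasi_eq0 eig_f) //].
exact/below0/below_child.
Qed.

Hypothesis card_inner : #|inner_vertices| = #|inner_leaves|.*2.

Lemma nonleaf_parent_of_leaf x : inner x -> x \notin inner_leaves ->
  exists2 z, z \in inner_leaves & parent z = x.
Proof.
move=> inner_x nleaf_x.
have leaf_inner z : z \in inner_leaves -> inner z by case/inner_leafP.
have parent_inj : {in inner_leaves &, injective parent}.
  move=> z z' leaf_z leaf_z' eq_p.
  apply: (leaf_inner_sibling leaf_z'); last exact: leaf_inner.
  by rewrite -eq_p child_parent // inner_neq_root ?leaf_inner.
have sub_inner : inner_leaves \subset inner_vertices.
  by apply/subsetP => z /leaf_inner; rewrite inE.
have sub_nonleaf :
    parent @: inner_leaves \subset inner_vertices :\: inner_leaves.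
  apply/subsetP => _ /imsetP [z leaf_z ->]; rewrite in_setD.
  by rewrite parent_not_inner_leaf ?leaf_inner // inE leaf_parent_inner.
have /setP/(_ x) : parent @: inner_leaves = inner_vertices :\: inner_leaves.
  apply/eqP; rewrite eqEcard sub_nonleaf card_in_imset //.
  by rewrite cardsD (setIidPr sub_inner) card_inner -addnn addnK leqnn.
by rewrite in_setD nleaf_x inE inner_x => /imsetP [z leaf_z ->]; exists z.
Qed.

Lemma nonleaf_parent_quasi x :
  inner x -> x \notin inner_leaves -> quasi (parent x).
Proof.
move=> inner_x nleaf_x; have ne_xr := inner_neq_root inner_x.
have /orP [inner_p|//] := inner_nbr inner_x (edge_parent ne_xr).
have [z leaf_z par_z] :=
  nonleaf_parent_of_leaf inner_p (parent_not_inner_leaf inner_x).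
have eq_xz : x = z.
  by apply: leaf_inner_sibling leaf_z _ inner_x; rewrite par_z child_parent.
by rewrite eq_xz leaf_z in nleaf_x.
Qed.

(* With [p] the parent of [z], the equations at [z] and at [p] for a function
   that is nonzero at [z] give [(deg z - 1) * (deg p - 1) = 1]. *)
Lemma leaf_degrees z :
  z \in inner_leaves -> degree e z = 2 /\ degree e (parent z) = 2.
Proof.
move=> leaf_z; have [f [eig_f fz _ _]] := leaf_eigenfun leaf_z.
have [inner_z _] := inner_leafP _ leaf_z.
have inner_p := leaf_parent_inner leaf_z.
have := leaf_parent_value eig_f leaf_z; rewrite fz mulr1 => fp.
have /eqP : f z = (((degree e (parent z))%:R - 1) * f (parent z))%R.
  apply: (lap_eigenfun_nbr eig_f).
    by rewrite sym_e edge_parent ?inner_neq_root.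
  move=> x; rewrite (rooted_edge t) => /orP [/andP [_ /eqP <-] _|px ne_xz].
    exact/(eigenfun_quasi_eq0 eig_f)/nonleaf_parent_quasi/parent_not_inner_leaf.
  have := inner_nbr inner_p (edge_child px).
  case/orP=> [inner_x|/(eigenfun_quasi_eq0 eig_f) //].
  by rewrite (leaf_inner_sibling leaf_z px inner_x) eqxx in ne_xz.
rewrite fz fp; have := inner_degree inner_z; have := inner_degree inner_p.
case: (degree e z) => // d; case: (degree e (parent z)) => // d' _ _.
rewrite -!natr1 !addrK -natrM eq_sym pnatr_eq1 muln_eq1.
by case/andP=> /eqP -> /eqP ->.
Qed.

Lemma inner_degree2 x : inner x -> degree e x = 2.
Proof.
move=> inner_x.
have [/leaf_degrees [] //|nleaf_x] := boolP (x \in inner_leaves).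
by have [z /leaf_degrees [_ <-] ->] := nonleaf_parent_of_leaf inner_x nleaf_x.
Qed.

End TightLeaves.

Section Extremal.
Hypothesis eq_m : 4 * m + 6 = #|T|.

Lemma extremal_cards : [/\ m = #|inner_leaves|,
  #|inner_vertices| = #|inner_leaves|.*2 & #|anchors| = 2].
Proof.
have := card_vertices; have := leaves_anchors_lt_quasi; have := anchors_gt1.
have := eigen_mult_le_leaves; have := double_eigen_mult_le_inner.
by move: eq_m n_gt5; split; lia.
Qed.

Lemma extremal_inner_degree x : inner x -> degree e x = 2.
Proof. by have [multE cardE _] := extremal_cards; apply: inner_degree2. Qed.

Lemma extremal_no_branching : inner_branchings = set0.
Proof.
apply/setP => z; rewrite !inE; apply/negbTE/and3P => -[inner_z deg_z _].
by rewrite extremal_inner_degree in deg_z.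
Qed.

Lemma extremal_path : exists w u, [/\ child r w, quasi_under quasi = [set w; u],
  u != w & forall x, ~~ pendant e x -> below u x].
Proof.
have [w [rw npw uniq_w]] := root_not_pendant_child.
have [ne_wr /eqP par_w] := andP rw.
have qw : quasi w.
  move: npw; rewrite not_pendantE => /orP [inner_w|//].
  by have := root_child_degree rw inner_w; rewrite extremal_inner_degree.
have under_w : w \in quasi_under quasi by rewrite inE qw ne_wr par_w.
have [_ _] := extremal_cards; rewrite /anchors extremal_no_branching set0U.
rewrite (cardsD1 w) under_w => -[] /eqP/cards1P [u def_u].
have /setD1P [ne_uw under_u] : u \in quasi_under quasi :\ w.
  by rewrite def_u set11.
have quasi_underE : quasi_under quasi = [set w; u].
  by rewrite -(setD1K under_w) def_u.
exists w, u; split=> // x npx.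
have [->|ne_xr] := eqVneq x r; first exact: below_root.
have [d [dx qd ne_dr]] := exists_quasi_below ne_xr npx.
case=> [qp|[inner_p dp]]; last first.
  by rewrite extremal_inner_degree in dp.
have : d \in quasi_under quasi by rewrite inE qd ne_dr.
rewrite quasi_underE => /set2P [eq_d|<- //]; rewrite {}eq_d in dx.
rewrite (below_root_child rw dx ne_xr).
move: under_u; rewrite inE => /and3P [qu ne_ur _].
exact: below_sole_root_child uniq_w ne_ur (quasiNpendant qu).
Qed.

Section Spine.
Variables w u : T.
Hypotheses (rw : child r w) (quasi_underE : quasi_under quasi = [set w; u]).
Hypotheses (ne_uw : u != w) (below_u : forall x, ~~ pendant e x -> below u x).

Let under_u : u \in quasi_under quasi.
Proof. by rewrite quasi_underE set22. Qed.
Let under_w : w \in quasi_under quasi.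
Proof. by rewrite quasi_underE set21. Qed.
Let quasi_u : quasi u. Proof. by move: under_u; rewrite inE => /and3P []. Qed.
Let quasi_w : quasi w. Proof. by move: under_w; rewrite inE => /and3P []. Qed.

Definition spine i : T := iter (depth u - i) parent u.

Lemma depth_spine i : i <= depth u -> depth (spine i) = i.
Proof. by move=> le_i; rewrite depth_iter subKn. Qed.

Lemma spine_depth x : ~~ pendant e x -> spine (depth x) = x.
Proof. by move=> npx; rewrite /spine -below_iter ?below_u. Qed.

Lemma depth_not_pendant_inj x y :
  ~~ pendant e x -> ~~ pendant e y -> depth x = depth y -> x = y.
Proof. by move=> npx npy eq_d; rewrite -(spine_depth npx) eq_d spine_depth. Qed.

Lemma spine_not_pendant i : ~~ pendant e (spine i).
Proof.
rewrite /spine; elim: (_ - _) => [|j IH] /=; first exact: quasiNpendant.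
have [->|] := eqVneq (iter j parent u) r; last exact: parent_not_pendant.
by rewrite parent_root quasiNpendant.
Qed.

Lemma child_spine i : i < depth u -> child (spine i) (spine i.+1).
Proof.
move=> lt_i; rewrite /child -(depth_eq0 t) depth_spine //=.
by rewrite /spine -iterS subnSK.
Qed.

Lemma spine0 : spine 0 = r.
Proof. by rewrite /spine subn0 iter_parent_root. Qed.

Lemma spine1 : spine 1 = w.
Proof.
by rewrite -(depth_root t) -(child_depth rw) spine_depth ?quasiNpendant.
Qed.

Lemma spine_end : spine (depth u) = u.
Proof. by rewrite /spine subnn. Qed.

Lemma quasi_spineS i : 0 < i -> i < depth u -> quasi (spine i) ->
  quasi (spine i.+1) = (i.+1 == depth u).
Proof.
move=> i_gt0 lt_i qi; apply/idP/eqP => [qi1|->]; last by rewrite spine_end.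
have [ne_r /eqP par_i] := andP (child_spine lt_i).
have : spine i.+1 \in quasi_under quasi by rewrite inE qi1 ne_r par_i.
rewrite quasi_underE => /set2P [eq_w|<-]; last by rewrite depth_spine.
have := depth_spine lt_i; rewrite eq_w (child_depth rw) depth_root => -[eq_i].
by rewrite -eq_i in i_gt0.
Qed.

Lemma inner_spineS i : 0 < i -> i.+1 < depth u -> quasi (spine i) ->
  [/\ i.+3 < depth u, inner (spine i.+1), inner (spine i.+2) &
      quasi (spine i.+3)].
Proof.
move=> i_gt0 lt_i1 qi; have [multE cardE _] := extremal_cards.
have lt_i := ltnW lt_i1; have [_ /eqP par_i1] := andP (child_spine lt_i).
have inner_i1 : inner (spine i.+1).
  by rewrite /inner_vertex spine_not_pendant quasi_spineS // ltn_eqF.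
have nleaf_i1 : spine i.+1 \notin inner_leaves.
  apply: contraL qi => /(leaf_parent_inner multE); rewrite par_i1.
  by case/andP.
have [z leaf_z par_z] := nonleaf_parent_of_leaf multE cardE inner_i1 nleaf_i1.
have [inner_z quasi_child] := inner_leafP _ leaf_z.
have npz := inner_not_pendant inner_z.
have dep_z : depth z = i.+2.
  by rewrite (depth_parent (inner_neq_root inner_z)) par_z depth_spine.
have [c zc] := not_pendant_child npz; have qc := quasi_child c zc.
have [_ /eqP par_c] := andP zc; have npc := quasiNpendant qc.
have dep_c : depth c = i.+3 by rewrite (child_depth zc) dep_z.
rewrite -dep_c -dep_z !spine_depth //; split=> //.
rewrite ltn_neqAle below_depth ?below_u // andbT; apply/eqP.
move/(depth_not_pendant_inj npc (quasiNpendant quasi_u)) => eq_cu.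
by move: under_u; rewrite inE -eq_cu par_c (inner_quasi inner_z) !andbF.
Qed.

Lemma quasi_spine_mod1 j : 3 * j + 1 < depth u -> quasi (spine (3 * j + 1)).
Proof.
elim: j => [|j IH] lt_j; first by rewrite spine1.
have lt_j1 : (3 * j + 1).+1 < depth u by lia.
have j_gt0 : 0 < 3 * j + 1 by rewrite addn1.
have [_ _ _] := inner_spineS j_gt0 lt_j1 (IH (ltnW lt_j1)).
by rewrite (_ : (3 * j + 1).+3 = 3 * j.+1 + 1) //; lia.
Qed.

Lemma depth_end_gt1 : 1 < depth u.
Proof.
have dep_w : depth w = 1 by rewrite (child_depth rw) depth_root.
have npw := quasiNpendant quasi_w.
rewrite ltn_neqAle -dep_w below_depth ?below_u // andbT.
apply: contra_neq ne_uw => eq_d.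
exact/esym/(depth_not_pendant_inj npw (quasiNpendant quasi_u)).
Qed.

Lemma inner_spine_gap j : 3 * j + 2 < depth u ->
  [/\ 3 * j + 4 < depth u, inner (spine (3 * j + 2)) &
      inner (spine (3 * j + 3))].
Proof.
rewrite !addnS addn0 => lt_j1.
have qj : quasi (spine (3 * j).+1).
  by rewrite -addn1 quasi_spine_mod1 ?addn1 1?ltnW.
by have [] := inner_spineS (ltn0Sn _) lt_j1 qj.
Qed.

Lemma depth_end_mod3 : depth u %% 3 = 2.
Proof.
have [j [c [lt_c def_u]]] := divn_offset (isT : 0 < 3) depth_end_gt1.
case: c lt_c => [|c] lt_c in def_u *; first by rewrite def_u mulnC modnMDl.
have [|lt_j _ _] := inner_spine_gap (j := j); first by rewrite def_u; lia.
by rewrite def_u in lt_j; lia.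
Qed.

Lemma quasi_spineE i : i <= depth u ->
  quasi (spine i) = [|| i == 0, i == depth u | i %% 3 == 1].
Proof.
move=> le_i; have [->|i_gt0] := posnP i; first by rewrite spine0 quasi_r.
have [->|ne_iu] := eqVneq i (depth u); first by rewrite spine_end quasi_u.
have {le_i} lt_i : i < depth u by rewrite ltn_neqAle ne_iu.
have [j [[|c] [lt_c def_i]]] := divn_offset (isT : 0 < 3) i_gt0.
  by rewrite def_i quasi_spine_mod1 -?def_i // def_i mulnC modnMDl orbT.
have [|_ inner2 inner3] := inner_spine_gap (j := j).
  by apply: leq_trans lt_i; rewrite def_i; lia.
have inner_i : inner (spine i) by rewrite def_i; case: c lt_c {def_i} => [|[|]].
rewrite inner_quasi // def_i mulnC modnMDl.
by case: c lt_c {def_i inner_i} => [|[|]].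
Qed.

Definition comb_pos x : bool * nat :=
  (pendant e x, if pendant e x then depth (parent x) else depth x).

Lemma comb_pos_inj : injective comb_pos.
Proof.
move=> x y [eq_p]; rewrite -eq_p; move/esym: eq_p; case: ifPn => px py eq_d.
  have eq_par : parent x = parent y.
    by apply: depth_not_pendant_inj; rewrite ?pendant_parent_not_pendant.
  apply: (pendant_of_quasi_uniq sym_e pq px py (x := parent x)).
    by rewrite pendant_nbr_parent.
  by rewrite eq_par pendant_nbr_parent.
by apply: depth_not_pendant_inj; rewrite ?py.
Qed.

Lemma comb_pos_adj x y : e x y = comb (comb_pos x) (comb_pos y).
Proof.
rewrite /comb /comb_pos /=; case: ifPn => px; case: ifPn => py /=.
- exact/negbTE/pendant_not_adjacent.
- rewrite sym_e pendant_nbr_parent //; apply/eqP/eqP => [-> //|].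
  by move/(depth_not_pendant_inj (pendant_parent_not_pendant px) py).
- rewrite pendant_nbr_parent //; apply/eqP/eqP => [-> //|].
  exact: depth_not_pendant_inj px (pendant_parent_not_pendant py).
have parentE a b : ~~ pendant e a -> ~~ pendant e b ->
    (a != r) && (parent a == b) = (depth a == (depth b).+1).
  move=> npa npb; apply/andP/eqP => [[ne_ar /eqP <-]|dep_a].
    exact: depth_parent.
  have ne_ar : a != r by rewrite -(depth_eq0 t) dep_a.
  split=> //; apply/eqP/depth_not_pendant_inj; rewrite ?parent_not_pendant //.
  by move: dep_a; rewrite (depth_parent ne_ar) => -[].
by rewrite orbF (rooted_edge t) !parentE.
Qed.

Lemma codom_comb_pos (p : bool * nat) : (p \in codom comb_pos) =
  (p.2 <= depth u) && (p.1 ==> quasi (spine p.2)).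
Proof.
apply/codomP/idP => [[x ->]|].
  rewrite /comb_pos; case: ifPn => px /=; last by rewrite below_depth ?below_u.
  have npp := pendant_parent_not_pendant px.
  rewrite below_depth ?below_u //= spine_depth //; apply: (quasi_pendantI px).
  by rewrite pendant_nbr_parent.
case: p => [[] i] /= /andP [le_i]; last first.
  exists (spine i).
  by rewrite /comb_pos (negPf (spine_not_pendant i)) depth_spine.
case/existsP=> y /andP [py]; rewrite pendant_nbr_parent // => /eqP eq_y.
by exists y; rewrite /comb_pos py -eq_y depth_spine.
Qed.

Lemma spine_iso : exists k, graph_iso e (@Tk k).
Proof.
have mod_u := depth_end_mod3; pose k := depth u %/ 3; exists k.
have def_u : depth u = 3 * k + 2 by rewrite (divn_eq (depth u) 3) mod_u mulnC.
apply: (graph_iso_codes comb_pos_inj (@Tk_comb_pos_inj k)).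
- move=> p; rewrite codom_comb_pos codom_Tk_comb_pos -def_u.
  by have [/quasi_spineE ->|//] := leqP p.2 (depth u).
- exact: comb_pos_adj.
- exact: Tk_comb_adj.
Qed.

End Spine.

Lemma extremal_iso : exists k, graph_iso e (@Tk k).
Proof. by have [w [u [*]]] := extremal_path; apply: (@spine_iso w u). Qed.

End Extremal.

End Eigenvalue1.

End PendantMatchedTree.

Lemma quasi_pendant_degree2 (T : finType) (e : rel T) :
    is_tree e -> 2 < #|T| -> num_pendant e = num_quasi_pendant e ->
  exists2 u, quasi_pendant e u & degree e u = 2.
Proof.
move=> tree_e n_gt2 pq; have [[sym_e _] _ conn_e _] := tree_e.
have /card_gt0P [r _] : 0 < #|T| by lia.
have [t root_t] := tree_rooting r tree_e.
have [|u [y [_ py uy deg_u]]] :=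
  lowest_quasi_pendant tree_e n_gt2 pq (t := t) (x := r).
  by rewrite root_t eqxx.
have qu : quasi_pendant e u by apply: quasi_pendantI py (edge_child uy).
exists u => //; rewrite deg_u; case: eqP deg_u => //= _ /eqP deg1.
by have := quasi_not_pendant sym_e conn_e n_gt2 qu; rewrite /pendant deg1.
Qed.

Local Open Scope ring_scope.

Theorem theorem1p2 (R : rcfType) (T : finType) (e : rel T)
    (tree_e : is_tree e) (n_ge6 : (6 <= #|T|)%N)
    (pq : num_pendant e = num_quasi_pendant e)
    (noP3 : ~ has_pendant_path 3 e) :
  ((eigen_mult (laplacian R e) 1)%:R <= (#|T|%:R - 6) / 4 :> rat) /\
  ((eigen_mult (laplacian R e) 1)%:R = (#|T|%:R - 6) / 4 :> rat <->
   exists k : nat, graph_iso e (@Tk k)).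
Proof.
have n_gt2 : (2 < #|T|)%N by exact: leq_trans n_ge6.
have [r quasi_r degree_r] := quasi_pendant_degree2 tree_e n_gt2 pq.
have [t root_t] := tree_rooting r tree_e; rewrite -root_t in quasi_r degree_r.
have bound := eigen_mult_bound tree_e n_gt2 pq n_ge6 quasi_r degree_r noP3 R.
have extremal :=
  extremal_iso tree_e n_gt2 pq n_ge6 quasi_r degree_r noP3 (F := R).
set m := eigen_mult _ _ in bound extremal *.
have eqE : m%:R = (#|T|%:R - 6) / 4 :> rat <-> (4 * m + 6 = #|T|)%N.
  split=> [eq_m|<-]; last by rewrite natrD natrM; field.
  by apply/eqP; rewrite -(eqr_nat rat) natrD natrM eq_m; apply/eqP; field.
split; first by rewrite ler_pdivlMr // lerBrDr -natrM -natrD ler_nat mulnC.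
rewrite eqE; split=> // -[k /(eigen_mult_iso_Tk R)].
rewrite -/m => -[le_km eq_n].
by apply/eqP; rewrite eqn_leq bound eq_n leq_add2r leq_mul2l.
Qed.
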